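(* Let $S$ be a Polish space. Let $(\mu_n)_{n\in\mathbb{N}}\subset\mathcal{M}(S)$ be a sequence such that $\langle\mu_n,f\rangle$ converges for every $f\in C_b(S)$. Then there exists $\mu_*\in\mathcal{M}(S)$ such that $\langle\mu_n,f\rangle\to\langle\mu_*,f\rangle$ for every $f\in C_b(S)$.
   Context: $\mathcal{M}(S)$ is the space of finite signed Borel measures on $S$, $C_b(S)$ is the space of bounded continuous real-valued functions on $S$, and $\langle\mu,f\rangle:=\int_S f\,d\mu$. *)

(* Defs.v *)
From HB Require Import structures.
From mathcomp Require Import all_boot all_order all_algebra.
From mathcomp Require Import all_classical all_reals all_analysis.

Set Implicit Arguments.
Unset Strict Implicit.
Unset Printing Implicit Defensive.

Import Order.TTheory GRing.Theory Num.Theory.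
Import numFieldNormedType.Exports.

Local Open Scope classical_set_scope.
Local Open Scope ring_scope.

Section polish.
Context {R : realType} {S : topologicalType}.
Implicit Type d : S -> S -> R.

Definition is_metric d :=
  [/\ forall x y, 0 <= d x y,
      forall x y, d x y = 0 <-> x = y,
      forall x y, d x y = d y x
    & forall x y z, d x z <= d x y + d y z].

Definition metrizes d :=
  forall (x : S) (A : set S),
    nbhs x A <-> exists2 e : R, 0 < e & [set y | d x y < e] `<=` A.

Definition complete_metric d :=
  forall u : nat -> S,
    (forall e : R, 0 < e ->
      exists N, forall m n, (N <= m)%N -> (N <= n)%N -> d (u m) (u n) < e) ->
    exists l : S, u n @[n --> \oo] --> l.

End polish.

Definition completely_metrizable (R : realType) (S : topologicalType) :=
  exists d : S -> S -> R, [/\ is_metric d, metrizes d & complete_metric d].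

Definition separable (S : topologicalType) :=
  exists2 D : set S, countable D & dense D.

Definition polish (R : realType) (S : topologicalType) :=
  separable S /\ completely_metrizable R S.

(* [measurableType] extends [pointedType], so these are only available for S a
   [ptopologicalType]. *)
Notation borel S := (g_sigma_algebraType (@open S)).

Notation signed_measure R S := ({charge set (borel S) -> \bar R}%R).

Definition bounded_continuous {R : realType} {S : topologicalType} :
    set (S -> R) :=
  [set f | continuous f /\ bounded_fun f].

Section charge_integral.
Context d {T : measurableType d} {R : realType}.
Implicit Types (nu : {charge set T -> \bar R}) (f : T -> R).

Lemma ex_hahn nu :
  exists PN : set T * set T, hahn_decomposition nu PN.1 PN.2.
Proof. by have [P [N nuPN]] := Hahn_decomposition nu; exists (P, N). Qed.

Definition hahnP nu :
    hahn_decomposition nu (sval (cid (ex_hahn nu))).1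
      (sval (cid (ex_hahn nu))).2 :=
  svalP (cid (ex_hahn nu)).

(* Integral with respect to a signed measure through its Jordan decomposition;
   as [Rintegral], it is only meaningful for f integrable with respect to both
   parts. *)
Definition charge_integral nu f : R :=
  \int[jordan_pos (hahnP nu)]_x f x - \int[jordan_neg (hahnP nu)]_x f x.

Lemma charge_integralE nu P N (nuPN : hahn_decomposition nu P N) f :
  charge_integral nu f = \int[jordan_pos nuPN]_x f x - \int[jordan_neg nuPN]_x f x.
Proof.
have uniq A : measurable A -> jordan_pos (hahnP nu) A = jordan_pos nuPN A /\
    jordan_neg (hahnP nu) A = jordan_neg nuPN A.
  move=> mA; have [eP eN] := Hahn_decomposition_uniq (hahnP nu) nuPN mA.
  rewrite !jordan_posE !jordan_negE !cjordan_posE !cjordan_negE.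
  by rewrite /crestr0 mem_set// /crestr eP eN.
by congr (_ - _); congr fine; apply: eq_measure_integral => A mA _;
  have [] := uniq _ mA.
Qed.

End charge_integral.

(* Main.v *)
Require Import Defs.
From HB Require Import structures.
From mathcomp Require Import all_boot all_order all_algebra.
From mathcomp Require Import all_classical all_reals all_analysis.
From mathcomp Require Import measurable_realfun ring lra.
Import Order.TTheory GRing.Theory Num.Theory.
Import numFieldNormedType.Exports.
Local Open Scope classical_set_scope.
Local Open Scope ring_scope.

Set Implicit Arguments.
Unset Strict Implicit.
Unset Printing Implicit Defensive.

(** Let [L f] be the limit of the integrals of [f]. It is a linear functional
    on bounded continuous functions, and it is the integral against a charge as
    soon as it is sigma-smooth: [L (f k)] tends to [0] whenever [f k] decreases
    pointwise to [0].

    Sigma-smoothness is the heart of the matter ([limit_sigma_smooth]). Given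
    such a sequence [f], every 0-1 sequence [a] selects a subseries
    [F a = \sum_k a k * (f k - f k.+1)], which is again bounded and continuous
    since its tails are dominated by the continuous functions [f K]. So the
    integrals of [F a] converge for all [a]. They depend continuously on [a] in
    the Cantor space, because the total variation of each single charge is
    sigma-smooth, and a Baire category argument ([oscillation_subseries]) yields
    a finite prefix such that, for every sequence extending it, all integrals of
    large index agree up to [e]. Compare the prefix followed by ones with the
    prefix followed by zeros: their subseries differ by [f K], so the integrals of
    [f K] are uniformly close to those against one fixed charge, which tend to
    [0].

    A linear sigma-smooth functional is the difference of two positive ones, its
    positive part [f |-> sup {L g | 0 <= g <= f}] and that of [- L]
    ([positive_partN]). The supremum is finite by sigma-smoothness again: were
    [L (g k) > 2 ^+ k] with [0 <= g k <= f], the tails of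
    [\sum_k 2 ^- k * g k] would decrease to [0] while their images under [L]
    keep making steps larger than [1].

    A positive sigma-smooth functional [P] is the integral against a measure
    ([daniell_representation]). The measure comes from the outer measure that
    approximates a set from above by increasing sequences in the domain of [P].
    Its Caratheodory sets include the open sets because in a metric space the
    indicator of an open set is an increasing limit of continuous functions. *)

(** * Bounded continuous functions *)

Local Notation Cb := bounded_continuous.

Lemma cvgn_distP (R : realType) (u : nat -> R) l :
  u n @[n --> \oo] --> l <->
  forall e, 0 < e -> exists N, forall n, (N <= n)%N -> `|u n - l| <= e.
Proof.
split=> [/cvgrPdist_le ul e e0|ul].
  by have [N _ uN] := ul e e0; exists N => n Nn; rewrite distrC; exact: uN.
apply/cvgrPdist_le => e e0; have [N uN] := ul e e0.
by exists N => // n Nn; rewrite distrC; exact: uN.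
Qed.

Section bounded_continuous_functions.
Context {R : realType} {S : topologicalType}.
Implicit Types f g : S -> R.

Lemma bounded_continuousP f :
  Cb f <-> continuous f /\ exists M, forall x, `|f x| <= M.
Proof.
split=> -[cf bf]; split=> //.
  have [M [_ bM]] := bf; exists (M + 1) => x.
  by apply: bM => //; rewrite ltrDl.
have [M bM] := bf; exists M; split; first exact: num_real.
by move=> N MN x _; exact: le_trans (bM x) (ltW MN).
Qed.

Lemma bounded_continuous_cst (c : R) : Cb (fun _ : S => c).
Proof.
apply/bounded_continuousP; split; first exact: cst_continuous.
by exists `|c|.
Qed.

Lemma bounded_continuousD f g : Cb f -> Cb g -> Cb (f + g).
Proof.
move=> /bounded_continuousP[cf [M fM]] /bounded_continuousP[cg [N gN]].
apply/bounded_continuousP; split.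
  by move=> x; apply: continuousD; [exact: cf|exact: cg].
exists (M + N) => x; rewrite (le_trans (ler_normD _ _))//.
by rewrite lerD.
Qed.

Lemma bounded_continuousM f g : Cb f -> Cb g -> Cb (f * g).
Proof.
move=> /bounded_continuousP[cf [M fM]] /bounded_continuousP[cg [N gN]].
apply/bounded_continuousP; split.
  by move=> x; apply: continuousM; [exact: cf|exact: cg].
exists (M * N) => x; rewrite [X in `|X|]/= normrM.
by rewrite ler_pM.
Qed.

Lemma bounded_continuousZ (c : R) f : Cb f -> Cb (c \*o f).
Proof. exact/bounded_continuousM/bounded_continuous_cst. Qed.

Lemma bounded_continuousB f g : Cb f -> Cb g -> Cb (f - g).
Proof.
move=> bf bg; rewrite (_ : - g = -1 \*o g).
  by apply: bounded_continuousD => //; exact: bounded_continuousZ.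
by apply/funext => x; rewrite /= mulN1r.
Qed.

Lemma bounded_continuous_min f g : Cb f -> Cb g -> Cb (f \min g).
Proof.
move=> /bounded_continuousP[cf [M fM]] /bounded_continuousP[cg [N gN]].
apply/bounded_continuousP; split.
  by move=> x; apply: continuous_min; [exact: cf|exact: cg].
exists (M + N) => x /=; rewrite minEle; case: ifP => _.
  by rewrite (le_trans (fM x))// lerDl (le_trans _ (gN x)).
by rewrite (le_trans (gN x))// lerDr (le_trans _ (fM x)).
Qed.

Lemma bounded_continuous_sum (I : Type) (r : seq I) (F : I -> S -> R) :
  (forall i, Cb (F i)) -> Cb (\sum_(i <- r) F i).
Proof.
move=> bF; apply: big_ind => //; first exact: (bounded_continuous_cst 0).
exact: bounded_continuousD.
Qed.

(** The error bounds [e k] need not be uniformly small: being continuous, one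
    that is small at a point stays small around it. *)
Lemma bounded_continuous_lim (F e : nat -> S -> R) f :
  (forall k, Cb (F k)) -> (forall k, Cb (e k)) ->
  (forall x, e k x @[k --> \oo] --> (0 : R)) ->
  (forall k x, `|f x - F k x| <= e k x) -> Cb f.
Proof.
move=> bF be e0 fFe; apply/bounded_continuousP; split.
  move=> x; apply/cvgrPdist_lt => eps eps0.
  have e30 : 0 < eps / 3 by lra.
  have [k _ ek] := (@cvgrPdist_lt _ _ _ _ _ _ _).1 (e0 x) _ e30.
  have {}ek := ek k (leqnn k); rewrite sub0r normrN in ek.
  have /bounded_continuousP[ce _] := be k.
  have /bounded_continuousP[cF _] := bF k.
  have Fy := (@cvgrPdist_lt _ _ _ _ _ _ _).1 (cF x) _ e30.
  have ey : \forall y \near x, e k y < eps / 3.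
    exact: (@cvgr_lt _ _ _ _ _ (e k x) (ce x) _ (le_lt_trans (ler_norm _) ek)).
  near=> y.
  have h1 : `|F k x - F k y| < eps / 3 by near: y; exact: Fy.
  have h2 : e k y < eps / 3 by near: y; exact: ey.
  have := fFe k x; have := fFe k y; have := ler_norm (e k x).
  move: h1 ek; rewrite !ltr_norml !ler_norml.
  by move=> /andP[? ?] /andP[? ?] ? /andP[? ?] /andP[? ?]; apply/andP; split; lra.
have /bounded_continuousP[_ [M FM]] := bF 0%N.
have /bounded_continuousP[_ [N eN]] := be 0%N.
exists (N + M) => x; rewrite -(subrK (F 0%N x) (f x)).
rewrite (le_trans (ler_normD _ _))// lerD// (le_trans (fFe 0%N x))//.
exact: le_trans (ler_norm _) (eN x).
Unshelve. all: by end_near. Qed.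

Definition nonneg_bounded_continuous : set (S -> R) :=
  [set f | Cb f /\ forall x, 0 <= f x].
Local Notation Cbp := nonneg_bounded_continuous.

Lemma nonneg_bounded_continuousD f g : Cbp f -> Cbp g -> Cbp (f + g).
Proof.
move=> [bf f0] [bg g0]; split; first exact: bounded_continuousD.
by move=> x; rewrite addr_ge0.
Qed.

Lemma nonneg_bounded_continuous_cst (c : R) : 0 <= c -> Cbp (fun _ : S => c).
Proof. by split=> //; exact: bounded_continuous_cst. Qed.

Lemma nonneg_bounded_continuousM f g : Cbp f -> Cbp g -> Cbp (f * g).
Proof.
move=> [bf f0] [bg g0]; split; first exact: bounded_continuousM.
by move=> x; rewrite mulr_ge0.
Qed.

Lemma nonneg_bounded_continuousB f g : Cb f -> Cb g -> (forall x, g x <= f x) ->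
  Cbp (f - g).
Proof.
move=> bf bg gf; split; first exact: bounded_continuousB.
by move=> x; rewrite !fctE subr_ge0.
Qed.

Lemma nonneg_bounded_continuous_sum (I : Type) (r : seq I) (F : I -> S -> R) :
  (forall i, Cbp (F i)) -> Cbp (\sum_(i <- r) F i).
Proof.
move=> pF; apply: big_ind => //; last exact: nonneg_bounded_continuousD.
exact: (nonneg_bounded_continuous_cst (lexx 0)).
Qed.

End bounded_continuous_functions.

Local Notation Cbp := nonneg_bounded_continuous.

(** * Linear functionals on bounded continuous functions *)

Section functionals.
Context {R : realType} {S : topologicalType}.
Implicit Types (f g : S -> R) (L : (S -> R) -> R).

Definition decreasing_to0 (f : nat -> S -> R) :=
  [/\ forall k, Cb (f k), forall x, nonincreasing_seq (f ^~ x)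
    & forall x, f k x @[k --> \oo] --> (0 : R)].

Lemma decreasing_to0_ge0 (f : nat -> S -> R) k x :
  decreasing_to0 f -> 0 <= f k x.
Proof.
move=> [_ df f0]; rewrite -(cvg_lim _ (f0 x))//.
by apply: nonincreasing_cvgn_ge => //; apply/cvg_ex; exists 0; exact: f0.
Qed.

(** Linearity is only asked on bounded continuous functions, as an integral has
    no reason to be additive elsewhere. *)
Definition bounded_continuous_linear L :=
  forall c f g, Cb f -> Cb g -> L (c \*o f + g) = c * L f + L g.

(** Daniell's continuity condition, which for an integral is a case of dominated
    convergence. *)
Definition sigma_smooth L :=
  forall f : nat -> S -> R, decreasing_to0 f -> L (f k) @[k --> \oo] --> (0 : R).

(** The total variation of [L] is sigma-smooth: the bound is uniform over the
    functions [h] lying below [f K] in absolute value. *)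
Definition variation_sigma_smooth L :=
  forall f : nat -> S -> R, decreasing_to0 f -> forall e : R, 0 < e ->
    exists K, forall h, Cb h -> (forall x, `|h x| <= f K x) -> `|L h| <= e.

Section linear_functional.
Variables (L : (S -> R) -> R) (linL : bounded_continuous_linear L).

Lemma bounded_continuous_linearD f g : Cb f -> Cb g -> L (f + g) = L f + L g.
Proof.
move=> bf bg; have := linL 1 bf bg; rewrite mul1r => <-; congr (L _).
by apply/funext => x; rewrite !fctE /= mul1r.
Qed.

Lemma bounded_continuous_linear0 : L 0 = 0.
Proof.
have b0 : Cb (0 : S -> R) := bounded_continuous_cst 0.
by have := bounded_continuous_linearD b0 b0; rewrite addr0; lra.
Qed.

Lemma bounded_continuous_linearZ c f : Cb f -> L (c \*o f) = c * L f.
Proof.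
move=> bf; have := linL c bf (bounded_continuous_cst 0).
by rewrite [fun=> 0](_ : _ = 0)// addr0 bounded_continuous_linear0 addr0.
Qed.

Lemma bounded_continuous_linearB f g : Cb f -> Cb g -> L (f - g) = L f - L g.
Proof.
move=> bf bg; rewrite [RHS]addrC -[- L g]mulN1r -linL//; congr (L _).
by apply/funext => x; rewrite !fctE /= mulN1r addrC.
Qed.

End linear_functional.

Lemma bounded_continuous_linearN L :
  bounded_continuous_linear L -> bounded_continuous_linear (fun f => - L f).
Proof. by move=> linL c f g bf bg; rewrite linL// opprD mulrN. Qed.

Lemma sigma_smoothN L : sigma_smooth L -> sigma_smooth (fun f => - L f).
Proof. by move=> sL f /sL L0; rewrite -oppr0; exact: cvgN. Qed.

End functionals.

(** * The integral against a charge *)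

Section charge_integral_functional.
Context {R : realType} {S : ptopologicalType}.
Implicit Types (f g : S -> R) (m : {finite_measure set (borel S) -> \bar R}).

Lemma continuous_borel_measurable f :
  continuous f -> measurable_fun [set: borel S] (f : borel S -> R).
Proof.
move=> /continuousP cf; apply: (measurability _ (RGenOpens.measurableE R)).
move=> _ [_ [a [b ->]] <-]; rewrite setTI; apply: sub_sigma_algebra.
exact/cf/interval_open.
Qed.

Lemma bounded_continuous_integrable m f :
  Cb f -> m.-integrable [set: borel S] (EFin \o f).
Proof.
move=> [cf bf]; apply: measurable_bounded_integrable => //.
  by rewrite -ge0_fin_numE// fin_num_measure.
exact: continuous_borel_measurable.
Qed.

Lemma Rintegral_decreasing_to0 m (f : nat -> S -> R) :
  decreasing_to0 f -> \int[m]_x f k x @[k --> \oo] --> (0 : R).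
Proof.
move=> f0; have [bf df cf] := f0.
have -> : 0 = fine (\int[m]_(x in [set: borel S]) (0 : \bar R)).
  by rewrite integral0.
apply: fine_cvg; rewrite fineK ?integral0//.
rewrite -[X in _ --> X](integral0 m [set: borel S]).
apply: (@dominated_cvg _ _ _ m _ _ _ (cst 0%:E) (EFin \o f 0%N)) => //.
- by move=> k; have /integrableP[] := bounded_continuous_integrable m (bf k).
- by move=> x _ /=; apply: cvg_EFin; [exact: nearW|exact: cf].
- exact: bounded_continuous_integrable.
- move=> k x _; rewrite lee_fin ger0_norm ?decreasing_to0_ge0//.
  exact: df.
Qed.

Lemma Rintegral_linear m :
  bounded_continuous_linear (fun f => \int[m]_x f x).
Proof.
move=> c f g bf bg; have bi := bounded_continuous_integrable m.
rewrite RintegralD//; [|exact/bi/bounded_continuousZ|exact: bi].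
by rewrite RintegralZl//; exact: bi.
Qed.

Lemma charge_integral_linear (nu : signed_measure R S) :
  bounded_continuous_linear (charge_integral nu).
Proof.
by move=> c f g bf bg; rewrite /charge_integral !Rintegral_linear//; ring.
Qed.

Lemma le_normr_Rintegral_dominated m f g : Cb f -> Cb g ->
  (forall x, `|f x| <= g x) -> `|\int[m]_x f x| <= \int[m]_x g x.
Proof.
move=> bf bg fg; have bi := bounded_continuous_integrable m.
apply: (le_trans (le_normr_Rintegral _ (bi _ bf))) => //.
by apply: le_Rintegral => //; [exact/integrable_norm/bi|exact: bi].
Qed.

Lemma charge_integral_variation_sigma_smooth (nu : signed_measure R S) :
  variation_sigma_smooth (charge_integral nu).
Proof.
move=> f f0 e e0; have [bf _ _] := f0.
have e20 : 0 < e / 2 by lra.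
have P0 := @cvgr_lt _ _ _ _ _ _
  (Rintegral_decreasing_to0 (jordan_pos (hahnP nu)) f0) _ e20.
have N0 := @cvgr_lt _ _ _ _ _ _
  (Rintegral_decreasing_to0 (jordan_neg (hahnP nu)) f0) _ e20.
near \oo => K; exists K => h bh hf; rewrite (le_trans (ler_normB _ _))//.
rewrite (splitr e) lerD//.
  apply: (le_trans (le_normr_Rintegral_dominated _ bh (bf K) hf)).
  by apply: ltW; near: K; exact: P0.
apply: (le_trans (le_normr_Rintegral_dominated _ bh (bf K) hf)).
by apply: ltW; near: K; exact: N0.
Unshelve. all: by end_near. Qed.

(** Any writing of a charge as a difference of finite measures computes its
    integral: it gives [m1 + nu^- = m2 + nu^+], an identity between measures,
    to which additivity of the integral in the measure applies. *)
Lemma charge_integral_difference (nu : signed_measure R S) m1 m2 f :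
  (forall A, measurable A -> nu A = (m1 A - m2 A)%E) -> Cb f ->
  charge_integral nu f = \int[m1]_x f x - \int[m2]_x f x.
Proof.
move=> nuE bf; have bi m := bounded_continuous_integrable m bf.
set p := jordan_pos (hahnP nu); set n := jordan_neg (hahnP nu).
have addE (m m' : {finite_measure set (borel S) -> \bar R}) :
    \int[m]_x f x + \int[m']_x f x = \int[measure_add m m']_x f x.
  rewrite /Rintegral integral_measure_add//.
  - by rewrite [RHS]fineD; [|apply: integrable_fin_num => //; exact: bi..].
  - exact: bi.
  - exact: bi.
apply/eqP; rewrite /charge_integral -/p -/n subr_eq addrAC eq_sym subr_eq eq_sym.
rewrite !addE; apply/eqP; congr fine; apply: eq_measure_integral => A mA _.
rewrite [LHS](measure_addE p m2) [RHS](measure_addE m1 n).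
suff : (p A + m2 A = m1 A + n A)%E by [].
have : (p A - n A = m1 A - m2 A)%E.
  rewrite -(nuE A mA) (jordan_decomp (hahnP nu) mA).
  by rewrite -mulN1e -EFinN.
have : m1 A \is a fin_num by exact: fin_num_measure.
have : m2 A \is a fin_num by exact: fin_num_measure.
have : p A \is a fin_num by exact: fin_num_measure.
have : n A \is a fin_num by exact: fin_num_measure.
move=> /fineK <- /fineK <- /fineK <- /fineK <-.
rewrite -!EFinN -!EFinD => -[h]; congr EFin; lra.
Qed.

End charge_integral_functional.

(** * Series dominated by a sequence decreasing to zero *)

Section dominated_series.
Context {R : realType} {S : topologicalType}.
Implicit Types (f w : nat -> S -> R) (x : S).

Definition series_fun w x : R := limn (fun K => \sum_(0 <= k < K) w k x).

(** The increments of [f] telescope, so a series of such [w] has its tail of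
    index [K] bounded by [f K]. *)
Definition increment_dominated f w :=
  forall k, Cb (w k) /\ forall x, 0 <= w k x <= f k x - f k.+1 x.

Variables (f w : nat -> S -> R).
Hypotheses (f0 : decreasing_to0 f) (wf : increment_dominated f w).

Lemma partial_series_bounds K K' x : (K <= K')%N ->
  0 <= \sum_(0 <= k < K') w k x - \sum_(0 <= k < K) w k x <= f K x - f K' x.
Proof.
move=> /subnK <-; elim: (K' - K)%N => [|j]; first by rewrite add0n !subrr lexx.
rewrite addSn big_nat_recr//=; have [_ /(_ x)] := wf (j + K).
by move=> /andP[? ?] /andP[? ?]; apply/andP; split; lra.
Qed.

Lemma series_fun_cvg x :
  \sum_(0 <= k < K) w k x @[K --> \oo] --> series_fun w x.
Proof.
apply: (@nondecreasing_is_cvgn R).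
  by move=> K K' KK'; have := partial_series_bounds x KK'; lra.
exists (f 0%N x) => _ [K _ <-]; have := partial_series_bounds x (leq0n K).
by have := decreasing_to0_ge0 K x f0; rewrite big_nil => ? /andP[? ?]; lra.
Qed.

Lemma series_fun_bounds K x :
  0 <= series_fun w x - \sum_(0 <= k < K) w k x <= f K x.
Proof.
have sK : \sum_(0 <= k < K') w k x - \sum_(0 <= k < K) w k x @[K' --> \oo] -->
    series_fun w x - \sum_(0 <= k < K) w k x.
  by apply: cvgB; [exact: series_fun_cvg|exact: cvg_cst].
apply/andP; split.
  apply: (cvgr_to_ge sK); exists K => // K' KK'.
  by case/andP: (partial_series_bounds x KK').
apply: (cvgr_to_le sK); exists K => // K' KK'.
case/andP: (partial_series_bounds x KK') => _ /le_trans; apply.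
by rewrite gerBl decreasing_to0_ge0.
Qed.

(** The bounds [f K] on the tails are continuous and vanish pointwise, so the
    sum is a limit in the sense of [bounded_continuous_lim]. *)
Lemma bounded_continuous_series_fun : Cb (series_fun w).
Proof.
have [bf _ cf] := f0.
apply: (bounded_continuous_lim (F := fun K => \sum_(0 <= k < K) w k) (e := f)).
- by move=> K; apply: bounded_continuous_sum => k; have [] := wf k.
- exact: bf.
- exact: cf.
- move=> K x; rewrite fct_sumE.
  by have /andP[? ?] := series_fun_bounds K x; rewrite ger0_norm.
Qed.

Lemma series_fun_tail_decreasing_to0 :
  decreasing_to0 (fun K => series_fun w - \sum_(0 <= k < K) w k).
Proof.
have [bf _ cf] := f0; split=> [K|x K K' KK'|x].
- apply: bounded_continuousB; first exact: bounded_continuous_series_fun.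
  by apply: bounded_continuous_sum => k; have [] := wf k.
- rewrite !fctE !fct_sumE; have := partial_series_bounds x KK'.
  by move=> /andP[? _]; lra.
- apply: (squeeze_cvgr _ (cvg_cst 0) (cf x)); apply: nearW => K.
  by rewrite !fctE fct_sumE; exact: series_fun_bounds.
Qed.

End dominated_series.

Section subseries.
Context {R : realType} {S : topologicalType}.
Variables (f : nat -> S -> R) (f0 : decreasing_to0 f).
Implicit Types (a b c : nat -> bool) (x : S).

Definition increments a k : S -> R := (a k)%:R \*o (f k - f k.+1).

Definition subseries a : S -> R := series_fun (increments a).

Lemma increment_dominated_increments a : increment_dominated f (increments a).
Proof.
have [bf df _] := f0; split.
  exact/bounded_continuousZ/bounded_continuousB.
move=> x; rewrite /increments !fctE /=; have := df x _ _ (leqnSn k).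
by case: (a k) => ?; rewrite ?(mul1r, mul0r); apply/andP; split; lra.
Qed.
Let dom := increment_dominated_increments.

Lemma bounded_continuous_subseries a : Cb (subseries a).
Proof. exact: bounded_continuous_series_fun f0 (dom a). Qed.

Lemma partial_subseries_agree a b K x : (forall k, (k < K)%N -> a k = b k) ->
  \sum_(0 <= k < K) increments a k x = \sum_(0 <= k < K) increments b k x.
Proof.
by move=> ab; apply: eq_big_nat => k /andP[_ /ab]; rewrite /increments => ->.
Qed.

Lemma subseries_agree a b K x : (forall k, (k < K)%N -> a k = b k) ->
  `|subseries a x - subseries b x| <= f K x.
Proof.
move=> /partial_subseries_agree ab; have := series_fun_bounds f0 (dom a) K x.
have := series_fun_bounds f0 (dom b) K x; rewrite ab ler_norml.
by move=> /andP[? ?] /andP[? ?]; apply/andP; split; rewrite /subseries; lra.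
Qed.

(** The tail [f K] telescopes into the terms of index at least [K]. *)
Lemma subseries_tail a K :
  subseries (fun k => (K <= k)%N || a k) - subseries (fun k => (k < K)%N && a k)
  = f K.
Proof.
have [bf _ cf] := f0; apply/funext => x.
set b := fun k => (K <= k)%N || a k; set c := fun k => (k < K)%N && a k.
have bc := @partial_subseries_agree b c K x.
suff : \sum_(0 <= k < K') increments b k x - \sum_(0 <= k < K') increments c k x
    @[K' --> \oo] --> f K x.
  by apply: cvg_unique => //; apply: cvgB; exact: series_fun_cvg f0 (dom _) x.
have fK : f K x - f K' x @[K' --> \oo] --> f K x.
  by rewrite -[X in _ --> X]subr0; apply: cvgB => //; exact: cvg_cst.
apply: cvg_trans fK; apply: near_eq_cvg; exists K => // K' /= /subnK <-.
elim: (K' - K)%N => [|j].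
  by rewrite add0n bc ?subrr// => k kK; rewrite /b /c kK leqNgt kK.
rewrite addSn !big_nat_recr//= /increments /b /c ltnNge leq_addl/=.
rewrite mul1r mul0r !fctE; lra.
Qed.

End subseries.

(** * Sigma-smoothness of a pointwise limit *)

Section pointwise_limit.
Context {R : realType} {S : topologicalType}.
Variables (I : nat -> (S -> R) -> R) (L : (S -> R) -> R).
Hypothesis linI : forall n, bounded_continuous_linear (I n).
Hypothesis smoothI : forall n, variation_sigma_smooth (I n).
Hypothesis IL : forall f, Cb f -> I n f @[n --> \oo] --> L f.

Lemma limit_bounded_continuous_linear : bounded_continuous_linear L.
Proof.
move=> c f g bf bg; apply: (cvg_unique _ (IL _)) => //.
  by apply: bounded_continuousD => //; exact: bounded_continuousZ.
rewrite (_ : (fun n => _) = (fun n => c * I n f + I n g)); last first.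
  by apply/funext => n; rewrite linI.
by apply: cvgD; [apply: cvgMl_tmp|]; exact: IL.
Qed.

(** The Baire category argument on the Cantor space, with prefixes of length [K]
    as basic open sets. If no prefix stabilizes the integrals from [N] on, then
    every prefix can be extended to a longer one on which two integrals of index
    at least [N] differ by more than [e]. Iterating over all [N], the union of the
    prefixes is a sequence whose integrals are not Cauchy. *)
Lemma oscillation_subseries (f : nat -> S -> R) (e : R) :
  decreasing_to0 f -> 0 < e ->
  exists N K a, forall b, (forall k, (k < K)%N -> b k = a k) ->
  forall n m, (N <= n)%N -> (N <= m)%N ->
    `|I n (subseries f b) - I m (subseries f b)| <= e.
Proof.
move=> f0 e0; apply: contrapT => noN; have [bf df _] := f0.
have F := bounded_continuous_subseries f0.
have step (t : nat * ((nat -> bool) * nat)) :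
    exists s : (nat -> bool) * nat, [/\ (t.2.2 < s.2)%N,
      forall k, (k < t.2.2)%N -> s.1 k = t.2.1 k
    & exists n m, [/\ (t.1 <= n)%N, (t.1 <= m)%N
      & forall c, (forall k, (k < s.2)%N -> c k = s.1 k) ->
        e < `|I n (subseries f c) - I m (subseries f c)|]].
  case: t => N [a K] /=; apply: contrapT => noS.
  apply: noN; exists N, K, a => b ba n m Nn Nm.
  rewrite leNgt; apply/negP => eb; apply: noS.
  set d := `|_| in eb; have d0 : 0 < (d - e) / 4 by lra.
  have [K1 IK1] := smoothI n f0 d0; have [K2 IK2] := smoothI m f0 d0.
  (* Beyond K1 and K2, changing the tail of b moves both integrals by at most
     (d - e) / 4, so that their distance d remains larger than e. *)
  exists (b, maxn K.+1 (maxn K1 K2)); split => //=; first by rewrite leq_max leqnn.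
  exists n, m; split => // c cb.
  have bh := bounded_continuousB (F c) (F b).
  have fle K' : (K' <= maxn K.+1 (maxn K1 K2))%N -> forall x,
      `|(subseries f c - subseries f b) x| <= f K' x.
    move=> K'K x; apply: (le_trans (subseries_agree f0 x cb)).
    exact: df.
  have := IK2 _ bh (fle K2 _); rewrite !leq_max leqnn !orbT => /(_ isT).
  have := IK1 _ bh (fle K1 _); rewrite !leq_max leqnn !orbT => /(_ isT).
  rewrite !(bounded_continuous_linearB (linI _))// => h1 h2.
  have : d <= `|I n (subseries f c) - I m (subseries f c)| +
      `|I n (subseries f c) - I n (subseries f b)| +
      `|I m (subseries f c) - I m (subseries f b)|.
    rewrite /d; set x1 := I n _; set x2 := I m _; set x3 := I n _.
    set x4 := I m _; have -> : x1 - x2 = (x3 - x4) - (x3 - x1) + (x4 - x2) by ring.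
    by rewrite (le_trans (ler_normD _ _))// lerD// (le_trans (ler_normB _ _)).
  lra.
(* The state is a sequence with the length of its settled prefix, and c is the
   diagonal through the states. Since k < (st k.+1).2, the k-th value is settled
   from step k.+1 on. *)
have [next nextP] := choice step.
pose st i := iteri i (fun i s => next (i, s)) (xpredT, 0%N).
have stP i := nextP (i, st i).
have mono i j : (i <= j)%N ->
    ((st i).2 <= (st j).2)%N /\
    forall k, (k < (st i).2)%N -> (st j).1 k = (st i).1 k.
  move=> /subnK <-; elim: (j - i)%N => // l [lK la].
  rewrite addSn; have [lt la' _] := stP (l + i)%N; split.
    exact: leq_trans lK (ltnW lt).
  by move=> k ki; rewrite [LHS]la' ?la// (leq_trans ki).
have geK i : (i <= (st i).2)%N.
  by elim: i => // i /leq_ltn_trans; apply; have [] := stP i.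
pose c k := (st k.+1).1 k.
have cst_ i k : (k < (st i).2)%N -> c k = (st i).1 k.
  move=> ki; have [ik|ki'] := leqP i k.+1; first exact: (mono _ _ ik).2.
  by rewrite [RHS](mono _ _ (ltnW ki')).2//; exact: geK.
have /cvgn_distP/(_ (e / 2))[|N LN] := IL (F c); first lra.
have [_ _ [n [m [/= Nn Nm]]]] := stP N => /(_ c (cst_ N.+1)).
have := LN n Nn; have := LN m Nm.
set x := I n _; set y := I m _ => h1 h2; apply/negP; rewrite -leNgt.
have -> : x - y = (x - L (subseries f c)) - (y - L (subseries f c)) by ring.
by rewrite (le_trans (ler_normB _ _))// (splitr e) lerD.
Qed.

(** By [subseries_tail], [f k] is the difference of two subseries sharing the
    prefix provided by [oscillation_subseries]. *)
Theorem limit_sigma_smooth : sigma_smooth L.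
Proof.
move=> f f0; apply/cvgn_distP => e e0; have e40 : 0 < e / 4 by lra.
have [bf df _] := f0; have F := bounded_continuous_subseries f0.
have [N [K [a osc]]] := oscillation_subseries f0 e40.
have [K0 IK0] := smoothI N f0 e40.
exists (maxn K K0) => k; rewrite geq_max => /andP[Kk K0k]; rewrite subr0.
have /cvgn_distP/(_ _ e40)[M LM] := IL (bf k).
set n := maxn N M; have := LM n (leq_maxr _ _).
have : `|I n (f k) - I N (f k)| <= e / 4 + e / 4.
  rewrite -(subseries_tail f0 a k) !(bounded_continuous_linearB (linI _))//.
  set b := fun _ => _ || _; set c := fun _ => _ && _.
  have bK j : (j < K)%N -> b j = a j.
    by move=> jK; rewrite /b leqNgt (leq_trans jK Kk).
  have cK j : (j < K)%N -> c j = a j.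
    by move=> jK; rewrite /c (leq_trans jK Kk).
  have := osc b bK n N (leq_maxl _ _) (leqnn _).
  have := osc c cK n N (leq_maxl _ _) (leqnn _).
  set x := I n _; set y := I N _; set z := I n _; set w := I N _ => h1 h2.
  have -> : z - x - (w - y) = (z - w) - (x - y) by ring.
  by rewrite (le_trans (ler_normB _ _))// lerD.
have : `|I N (f k)| <= e / 4.
  apply: IK0 => // x; rewrite ger0_norm ?decreasing_to0_ge0//.
  exact: df.
set x := I N _; set y := I n _ => h1 h2 h3.
have -> : L (f k) = x + (y - x) - (y - L (f k)) by ring.
rewrite (le_trans (ler_normB _ _))//.
have := ler_normD x (y - x); lra.
Qed.

End pointwise_limit.

(** * The positive part of a sigma-smooth functional *)

Section positive_part.
Context {R : realType} {S : topologicalType}.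
Implicit Types (f g h : S -> R) (L : (S -> R) -> R).

Definition minorants f := [set g | Cb g /\ forall x, 0 <= g x <= f x].

Definition positive_part L f : R := sup (L @` minorants f).

Variables (L : (S -> R) -> R).
Hypotheses (linL : bounded_continuous_linear L) (smoothL : sigma_smooth L).

(** If [L (g k) > 2 ^+ k] for minorants [g k], the tails of the series of
    [2 ^- k * g k] decrease to [0] since the series is dominated by the increments
    of [2 * 2 ^- k * f], but [L] decreases by more than [1] from each tail to the
    next. *)
Lemma minorants_bounded f : Cbp f -> has_ubound (L @` minorants f).
Proof.
move=> [bf f_ge0]; apply: contrapT => noub.
have step k : exists g, minorants f g /\ 2 ^+ k < L g.
  apply: contrapT => nog; apply: noub; exists (2 ^+ k) => _ [g gf <-].
  by rewrite leNgt; apply/negP => kg; apply: nog; exists g.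
have [g gP] := choice step.
pose w k : S -> R := (2 ^- k) \*o g k.
pose d k : S -> R := (2 * 2 ^- k) \*o f.
have d0 : decreasing_to0 d.
  split=> [k|x|x].
  - exact: bounded_continuousZ.
  - apply/nonincreasing_seqP => k; rewrite /d /= ler_wpM2r// ler_wpM2l//.
    by rewrite lef_pV2 ?posrE ?exprn_gt0// ler_eXn2l// ltr1n.
  - rewrite (_ : (fun k => d k x) = geometric (2 * f x) (2^-1)).
      by apply: cvg_geometric; rewrite ger0_norm// invf_lt1// ltr1n.
    by apply/funext => k; rewrite /d /geometric /= exprVn; ring.
have wd : increment_dominated d w.
  move=> k; have [[bg gf] _] := gP k; split; first exact: bounded_continuousZ.
  move=> x; have /andP[g0 gfx] := gf x; rewrite /w /d /= exprS invfM.
  have k0 : 0 < (2:R) ^- k by rewrite invr_gt0 exprn_gt0.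
  apply/andP; split; first by rewrite mulr_ge0// ltW.
  have -> : 2 * 2 ^- k * f x - 2 * (2^-1 * 2 ^- k) * f x = 2 ^- k * f x by field.
  by rewrite ler_wpM2l// ltW.
have t0 := series_fun_tail_decreasing_to0 d0 wd; have [bt _ _] := t0.
have /cvgn_distP/(_ 4^-1)[|N tN] := smoothL t0; first by [].
have := tN _ (leqnn N); have := tN _ (leqnSn N); rewrite !subr0.
have [[[bg _] gN] [bw _]] := (gP N, wd N).
have : L (series_fun w - \sum_(0 <= k < N) w k) -
    L (series_fun w - \sum_(0 <= k < N.+1) w k) = 2 ^- N * L (g N).
  rewrite -(bounded_continuous_linearB linL)// -(bounded_continuous_linearZ linL)//.
  by rewrite big_nat_recr//=; congr L; rewrite [LHS](_ : _ = w N)//; ring.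
have : 1 < 2 ^- N * L (g N) by rewrite mulrC ltr_pdivlMr ?mul1r// exprn_gt0.
rewrite !ler_norml; lra.
Qed.

Lemma positive_part_ge f g : Cbp f -> minorants f g -> L g <= positive_part L f.
Proof. by move=> /minorants_bounded fub gf; apply: ub_le_sup => //; exists g. Qed.

Lemma minorants0 f : Cbp f -> minorants f 0.
Proof.
move=> [_ f0]; split; first exact: (bounded_continuous_cst 0).
by move=> x; rewrite f0 lexx.
Qed.

Lemma positive_part_le f v : Cbp f ->
  (forall g, minorants f g -> L g <= v) -> positive_part L f <= v.
Proof.
move=> f0 fv; apply: ge_sup; last by move=> _ [g gf <-]; exact: fv.
by exists (L 0), 0 => //; exact: minorants0.
Qed.

Lemma positive_part_adherent f e : Cbp f -> 0 < e ->
  exists2 g, minorants f g & positive_part L f - e < L g.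
Proof.
move=> f0 e0; have [|_ [g gf <-] ge] := @sup_adherent _ (L @` minorants f) _ e0.
  by split; [exists (L 0), 0 => //; exact: minorants0|exact: minorants_bounded].
by exists g.
Qed.

Lemma positive_part_ge0 f : Cbp f -> 0 <= positive_part L f.
Proof.
move=> f0; rewrite -(bounded_continuous_linear0 linL).
exact/positive_part_ge/minorants0.
Qed.

(** For the upper bound, [h <= f + g] splits into [h \min f <= f] and
    [h - h \min f <= g] (Riesz decomposition). *)
Lemma positive_partD f g : Cbp f -> Cbp g ->
  positive_part L (f + g) = positive_part L f + positive_part L g.
Proof.
move=> pf pg; have pfg := nonneg_bounded_continuousD pf pg.
have [[bf f0] [bg g0]] := (pf, pg).
apply/eqP; rewrite eq_le; apply/andP; split.
  apply: positive_part_le => // h [bh hfg].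
  have bm := bounded_continuous_min bh bf.
  rewrite -(subrK (h \min f) h) (bounded_continuous_linearD linL)//; last first.
    exact: bounded_continuousB.
  rewrite addrC lerD//; apply: positive_part_ge => //; split=> //.
  - by move=> x; have /andP[h0 _] := hfg x; rewrite le_min h0 f0 /= ge_min lexx orbT.
  - exact: bounded_continuousB.
  - move=> x; rewrite !fctE /= subr_ge0 ge_min lexx /=.
    have := hfg x; have := g0 x; rewrite !fctE minEle.
    by case: (leP (h x) (f x)) => ? ? /andP[? ?]; lra.
rewrite -lerBrDr; apply: positive_part_le => // h [bh hf].
rewrite lerBrDr -lerBrDl; apply: positive_part_le => // k [bk kg].
rewrite lerBrDl -(bounded_continuous_linearD linL)//; apply: positive_part_ge => //.
split; first exact: bounded_continuousD.
by move=> x; rewrite !fctE; have := hf x; have := kg x; lra.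
Qed.

(** Let [g] be an almost optimal minorant of [f 0]. As [g - g \min f k] is a
    minorant of [f 0 - f k], additivity bounds the value at [f k] by the
    optimality defect of [g] plus [L (g \min f k)], which tends to [0]. *)
Lemma positive_part_sigma_smooth : sigma_smooth (positive_part L).
Proof.
move=> f f0; have [bf df cf] := f0.
have pf k : Cbp (f k) by split=> // x; exact: decreasing_to0_ge0.
apply/cvgn_distP => e e0; have e20 : 0 < e / 2 by lra.
have [g [bg gf] ge] := positive_part_adherent (pf 0%N) e20.
have bm k := bounded_continuous_min bg (bf k).
have m0 : decreasing_to0 (fun k => g \min f k).
  split => // x.
    by move=> k k' /(df x) kk' /=; rewrite le_min !ge_min lexx kk' orbT.
  apply: (squeeze_cvgr _ (cvg_cst 0) (cf x)); apply: nearW => k /=.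
  rewrite le_min ge_min lexx orbT andbT decreasing_to0_ge0// andbT.
  by case/andP: (gf x).
have /cvgn_distP/(_ _ e20)[N mN] := smoothL m0.
exists N => k /mN; rewrite !subr0 => mk; rewrite ger0_norm ?positive_part_ge0//.
have pd : Cbp (f 0%N - f k).
  split; first exact: bounded_continuousB.
  by move=> x; rewrite !fctE subr_ge0; exact: df.
have := positive_partD pd (pf k); rewrite subrK.
have : L (g - (g \min f k)) <= positive_part L (f 0%N - f k).
  apply: positive_part_ge => //; split; first exact: bounded_continuousB.
  move=> x; rewrite !fctE /= subr_ge0 ge_min lexx /=.
  have := gf x; have := df x _ _ (leq0n k); rewrite minEle.
  by case: (leP (g x) (f k x)) => ? ? /andP[? ?]; lra.
rewrite (bounded_continuous_linearB linL)//.
have := ler_norm (L (g \min f k)); lra.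
Qed.

End positive_part.

(** [g |-> f - g] exchanges the minorants of [f]. *)
Lemma positive_partN (R : realType) (S : topologicalType) (L : (S -> R) -> R) f :
  bounded_continuous_linear L -> sigma_smooth L -> nonneg_bounded_continuous f ->
  positive_part L f - positive_part (fun g => - L g) f = L f.
Proof.
move=> linL smoothL pf; have [bf f0] := pf.
have linN := bounded_continuous_linearN linL; have smoothN := sigma_smoothN smoothL.
have compl g : minorants f g -> minorants f (f - g).
  move=> [bg gf]; split; first exact: bounded_continuousB.
  by move=> x; rewrite !fctE; have := gf x; lra.
apply/eqP; rewrite eq_le; apply/andP; split.
  rewrite lerBlDr; apply: positive_part_le => // g gf.
  have := positive_part_ge linN smoothN pf (compl _ gf).
  by rewrite (bounded_continuous_linearB linL)//; [lra|case: gf].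
rewrite lerBrDr addrC -lerBrDr; apply: positive_part_le => // g gf.
have := positive_part_ge linL smoothL pf (compl _ gf).
by rewrite (bounded_continuous_linearB linL)//; [lra|case: gf].
Qed.

(** * Approximating open sets by continuous functions *)

Section open_indicator.
Context {R : realType} {S : topologicalType}.
Variable d : S -> S -> R.
Hypotheses (dmet : is_metric d) (dtop : metrizes d).

(** The distance to the complement of [U], truncated at [1] so as to be meaningful
    when the complement is empty. *)
Definition dist_compl (U : set S) x : R :=
  inf [set r | r = 1 \/ exists2 y, ~ U y & r = d x y].

Lemma dist_compl_le U x r :
  r = 1 \/ (exists2 y, ~ U y & r = d x y) -> dist_compl U x <= r.
Proof.
have [d_ge0 _ _ _] := dmet.
move=> Ur; apply: ge_inf => //; exists 0 => _ [->|[y _ ->]]; first exact: ler01.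
exact: d_ge0.
Qed.

Lemma le_dist_compl U x v : v <= 1 -> (forall y, ~ U y -> v <= d x y) ->
  v <= dist_compl U x.
Proof.
move=> v1 vd; apply: lb_le_inf; first by exists 1; left.
by move=> _ [->|[y Uy ->]] //; exact: vd.
Qed.

Lemma dist_compl_lip U x z : dist_compl U x - d x z <= dist_compl U z.
Proof.
have [d_ge0 _ _ dtri] := dmet; apply: le_dist_compl.
  rewrite lerBlDr (@le_trans _ _ 1)//; last by rewrite lerDl.
  by apply: dist_compl_le; left.
move=> y Uy; rewrite lerBlDl (le_trans _ (dtri x z y))//.
by apply: dist_compl_le; right; exists y.
Qed.

Lemma continuous_dist_compl U : continuous (dist_compl U : S -> R).
Proof.
have [d_ge0 _ dsym _] := dmet.
move=> x; apply/cvgrPdist_lt => e e0; apply/dtop; exists e => // y /= xy.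
have := dist_compl_lip U x y; have := dist_compl_lip U y x.
by rewrite (dsym y x) ltr_norml => ? ?; apply/andP; split; lra.
Qed.

Lemma dist_compl_ge0 U x : 0 <= dist_compl U x.
Proof. by have [d_ge0 _ _ _] := dmet; apply: le_dist_compl. Qed.

Lemma dist_compl_eq0 U x : ~ U x -> dist_compl U x = 0.
Proof.
have [_ d0 _ _] := dmet.
move=> Ux; apply/eqP; rewrite eq_le dist_compl_ge0 andbT.
by apply: dist_compl_le; right; exists x => //; exact/esym/d0.
Qed.

Lemma dist_compl_gt0 U x : open U -> U x -> 0 < dist_compl U x.
Proof.
move=> oU Ux; have /dtop[e e0 eU] : nbhs x U by exact: open_nbhs_nbhs.
apply: (@lt_le_trans _ _ (Num.min 1 e)); first by rewrite lt_min ltr01.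
apply: le_dist_compl; first by rewrite ge_min lexx.
by move=> y Uy; rewrite ge_min orbC leNgt; case: ltP => // /eU Uy'; case: Uy.
Qed.

Lemma open_indicator_approx U : open U -> exists h : nat -> S -> R,
  [/\ forall k, Cb (h k), forall k x, 0 <= h k x <= 1,
      forall x, nondecreasing_seq (h ^~ x), forall k x, ~ U x -> h k x = 0
    & forall x, U x -> exists k, h k x = 1].
Proof.
move=> oU; exists (fun k x => Num.min 1 (k%:R * dist_compl U x)); split.
- move=> k; apply/bounded_continuousP; split.
    move=> x.
    apply: (@continuous_min _ _ (fun=> 1) (fun x => k%:R * dist_compl U x)).
      exact: cst_continuous.
    by apply: cvgMl_tmp; exact: continuous_dist_compl.
  exists 1 => x; rewrite ger0_norm ?ge_min ?lexx//.
  by rewrite le_min ler01 mulr_ge0// dist_compl_ge0.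
- by move=> k x; rewrite ge_min lexx le_min ler01 mulr_ge0// dist_compl_ge0.
- move=> x k k' kk'; rewrite le_min !ge_min lexx /=; apply/orP; right.
  by rewrite ler_wpM2r ?dist_compl_ge0// ler_nat.
- by move=> k x /dist_compl_eq0 ->; rewrite mulr0 minEle ler10.
- move=> x Ux; have d0 := dist_compl_gt0 oU Ux.
  have dV0 : 0 <= (dist_compl U x)^-1 by rewrite invr_ge0 ltW.
  exists (Num.bound (dist_compl U x)^-1); apply/min_idPl.
  by rewrite -ler_pdivrMr// div1r ltW// archi_boundP.
Qed.

End open_indicator.

(** * The outer measure of a positive functional *)

Section daniell_outer_measure.
Context {R : realType} {S : topologicalType}.
Implicit Types (f g h : S -> R) (A : set S) (v : R).
Variables (P : (S -> R) -> R).
Hypotheses (P_ge0 : forall f, Cbp f -> 0 <= P f)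
  (PD : forall f g, Cbp f -> Cbp g -> P (f + g) = P f + P g)
  (smoothP : sigma_smooth P).

Lemma additiveB f g : Cbp f -> Cbp g -> (forall x, g x <= f x) ->
  P (f - g) = P f - P g.
Proof.
move=> pf pg gf; have [[bf _] [bg _]] := (pf, pg).
have := PD (nonneg_bounded_continuousB bf bg gf) pg; rewrite subrK; lra.
Qed.

Lemma additive_le f g : Cbp f -> Cbp g -> (forall x, g x <= f x) -> P g <= P f.
Proof.
move=> pf pg gf; have [[bf _] [bg _]] := (pf, pg).
by rewrite -subr_ge0 -additiveB//; apply/P_ge0/nonneg_bounded_continuousB.
Qed.

Lemma additive0 : P 0 = 0.
Proof.
have p0 : Cbp (0 : S -> R) := nonneg_bounded_continuous_cst (lexx 0).
by have := PD p0 p0; rewrite addr0; lra.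
Qed.

Lemma additive_sum (I : Type) (r : seq I) (F : I -> S -> R) :
  (forall i, Cbp (F i)) -> P (\sum_(i <- r) F i) = \sum_(i <- r) P (F i).
Proof.
move=> pF; elim: r => [|i r ih]; first by rewrite !big_nil additive0.
by rewrite !big_cons PD ?ih//; exact: nonneg_bounded_continuous_sum.
Qed.

Lemma additiveMn f n : Cbp f -> P (f *+ n) = P f *+ n.
Proof.
move=> pf; rewrite -[n in LHS]subn0 -sumr_const_nat.
by rewrite additive_sum// sumr_const_nat subn0.
Qed.

(** [v] dominates the value of a lower semicontinuous majorant of the indicator
    of [A], given as an increasing limit. Compared with series of functions,
    increasing limits have the advantage that countably many of them add up along
    a diagonal. *)
Definition majorized A v := exists u : nat -> S -> R,
  [/\ forall k, Cbp (u k), forall x, nondecreasing_seq (u ^~ x),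
      forall x, A x -> exists k, 1 <= u k x & forall k, P (u k) <= v].

Definition daniell_outer A : \bar R := ereal_inf (EFin @` majorized A).

Local Open Scope ereal_scope.

Lemma daniell_outer_le A v : majorized A v -> daniell_outer A <= v%:E.
Proof. by move=> Av; apply: ereal_inf_lbound; exists v. Qed.

Lemma le_daniell_outer A (y : \bar R) :
  (forall v, majorized A v -> y <= v%:E) -> y <= daniell_outer A.
Proof. by move=> Ay; apply: le_ereal_inf_tmp => _ [v Av <-]; exact: Ay. Qed.

Lemma majorized_fun A f : Cbp f -> (forall x, A x -> 1 <= f x)%R ->
  majorized A (P f).
Proof.
move=> pf Af; exists (fun=> f); split => // x; first by move=> ? ?.
by exists 0%N; exact: Af.
Qed.

Lemma daniell_outer_ge0 A : 0 <= daniell_outer A.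
Proof.
apply: le_daniell_outer => v [u [pu _ _ uv]]; rewrite lee_fin.
exact: le_trans (P_ge0 (pu 0%N)) (uv 0%N).
Qed.

Lemma daniell_outer_fin_num A : daniell_outer A \is a fin_num.
Proof.
rewrite ge0_fin_numE ?daniell_outer_ge0//.
have p1 : Cbp (1%R : S -> R) := nonneg_bounded_continuous_cst ler01.
by apply: le_lt_trans (daniell_outer_le (majorized_fun p1 _)) (ltry _).
Qed.

Lemma daniell_outer0 : daniell_outer set0 = 0.
Proof.
apply/eqP; rewrite eq_le daniell_outer_ge0 andbT -[leRHS]/(0%:E) -additive0.
apply/daniell_outer_le/majorized_fun => //.
exact: (nonneg_bounded_continuous_cst (lexx 0%R)).
Qed.

Lemma le_daniell_outer_set : {homo daniell_outer : A B / A `<=` B >-> A <= B}.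
Proof.
move=> A B AB; apply: le_daniell_outer => v [u [pu ndu Bu uv]].
by apply: daniell_outer_le; exists u; split => // x /AB /Bu.
Qed.

(** At stage [k], sum the [k]-th functions of the first [k] majorants. *)
Lemma majorized_bigcup (A : nat -> set S) (v : nat -> R) (c : R) :
  (forall i, majorized (A i) (v i)) ->
  (forall n, \sum_(0 <= i < n) v i <= c)%R -> majorized (\bigcup_i A i) c.
Proof.
move=> /choice[u uP] vc; exists (fun k => \sum_(0 <= i < k) u i k)%R; split.
- by move=> k; apply: nonneg_bounded_continuous_sum => i; have [] := uP i.
- move=> x k k' kk'; rewrite !fct_sumE.
  rewrite [leRHS](big_cat_nat (leq0n k) kk')/= -[leLHS]addr0 lerD//.
    by apply: ler_sum => i _; have [_ ndu _ _] := uP i; exact: ndu.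
  by apply: sumr_ge0 => i _; have [pu _ _ _] := uP i; have [_] := pu k'; exact.
- move=> x [i _ Aix]; have [pu ndu /(_ x Aix)[k uk] _] := uP i.
  exists (maxn i.+1 k); rewrite fct_sumE.
  have ik : (i < maxn i.+1 k)%N by rewrite leq_max leqnn.
  rewrite (bigD1_seq i) ?mem_index_iota ?iota_uniq//=.
  rewrite -[leLHS]addr0 lerD//; first exact: le_trans uk (ndu _ _ _ (leq_maxr _ _)).
  apply: sumr_ge0 => j _; have [pj _ _ _] := uP j.
  by have [_] := pj (maxn i.+1 k); exact.
- move=> k; rewrite additive_sum; last by move=> i; have [] := uP i.
  by apply: le_trans (vc k); apply: ler_sum => i _; have [_ _ _] := uP i; exact.
Qed.

Lemma daniell_outer_sigma_subadditive : sigma_subadditive daniell_outer.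
Proof.
move=> A; have [|soo] := leP +oo (\sum_(i <oo) daniell_outer (A i)).
  by rewrite leye_eq => /eqP ->; rewrite leey.
have s0 : 0 <= \sum_(i <oo) daniell_outer (A i).
  by apply: nneseries_ge0 => i _ _; exact: daniell_outer_ge0.
apply/lee_addgt0Pr => e e0.
have step i : exists v, majorized (A i) v /\
    v%:E <= daniell_outer (A i) + (e / (2 ^ i.+1)%:R)%:E.
  have ei : (0 < e / (2 ^ i.+1)%:R)%R by rewrite divr_gt0// ltr0n expn_gt0.
  have [_ [v Av <-] /ltW ve] :=
    lb_ereal_inf_adherent ei (daniell_outer_fin_num (A i)).
  by exists v.
have [v vP] := choice step.
have sfin : \sum_(i <oo) daniell_outer (A i) \is a fin_num by rewrite ge0_fin_numE.
rewrite -(fineK sfin) -EFinD; apply: daniell_outer_le.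
apply: (@majorized_bigcup A v) => [i|n]; first by have [] := vP i.
rewrite -lee_fin EFinD fineK//.
have oA i := daniell_outer_ge0 (A i).
apply: (le_trans _ (epsilon_trick xpredT oA (ltW e0))).
apply: (@le_trans _ _
  (\sum_(0 <= i < n) (daniell_outer (A i) + (e / (2 ^ i.+1)%:R)%:E))).
  by rewrite -sumEFin; apply: lee_sum => i _; have [] := vP i.
apply: nneseries_lim_ge => i _; rewrite adde_ge0 ?daniell_outer_ge0//.
by rewrite lee_fin divr_ge0// ltW.
Qed.

(** The increasing approximations [u k * h k] and [u k * (1 - h j)] split a
    majorant [u] between the two parts of [A]; a single [j] serves all [k] as
    [P (u k * h k)] is close to its supremum from [j] on. *)
Lemma daniell_outer_split A (U : set S) (h : nat -> S -> R) :
  (forall k, Cb (h k)) -> (forall k x, 0 <= h k x <= 1)%R ->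
  (forall x, nondecreasing_seq (h ^~ x)) ->
  (forall k x, ~ U x -> h k x = 0%R) -> (forall x, U x -> exists k, h k x = 1%R) ->
  daniell_outer (A `&` U) + daniell_outer (A `&` ~` U) <= daniell_outer A.
Proof.
move=> bh h01 ndh hU0 hU1; apply: le_daniell_outer => v [u [pu ndu Au uv]].
have ph k : Cbp (h k) by split=> // x; case/andP: (h01 k x).
have p1 : Cbp (1%R : S -> R) := nonneg_bounded_continuous_cst ler01.
have pc k : Cbp (1 - h k)%R.
  apply: nonneg_bounded_continuousB; [by case: p1|exact: bh|].
  by move=> x; case/andP: (h01 k x).
have puh k j : Cbp (u k * h j)%R by exact: nonneg_bounded_continuousM.
have puc k j : Cbp (u k * (1 - h j))%R by exact: nonneg_bounded_continuousM.
have PuE k j : (P (u k) = P (u k * h j) + P (u k * (1 - h j)))%R.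
  by rewrite -PD//; congr P; ring.
pose E := range (fun k => P (u k * h k)%R).
have Ev : has_sup E.
  split; first by exists (P (u 0%N * h 0%N)%R), 0%N.
  exists v => _ [k _ <-]; rewrite (le_trans _ (uv k))// (PuE k k) lerDl.
  exact: P_ge0.
have AU : majorized (A `&` U) (sup E).
  exists (fun k => u k * h k)%R; split => //.
  - move=> x k k' kk'; rewrite !fctE; have [[_ u0] [_ h0]] := (pu k, ph k).
    by apply: ler_pM; [exact: u0|exact: h0|exact: ndu|exact: ndh].
  - move=> x [Ax Ux]; have [k1 uk1] := Au x Ax; have [k2 hk2] := hU1 x Ux.
    exists (maxn k1 k2); rewrite !fctE.
    have u1 := le_trans uk1 (ndu x _ _ (leq_maxl k1 k2)).
    have := ndh x _ _ (leq_maxr k1 k2); rewrite hk2 => h1.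
    by rewrite -[leLHS]mulr1 ler_pM.
  - by move=> k; apply: sup_upper_bound => //; exists k.
apply/lee_addgt0Pr => e e0; have [_ [j _ <-] je] := sup_adherent e0 Ev.
have AC : majorized (A `&` ~` U) (v - sup E + e).
  exists (fun k => u k * (1 - h j))%R; split => //.
  - move=> x k k' kk'; rewrite !fctE ler_wpM2r//; last exact: ndu.
    by have [_] := pc j; exact.
  - move=> x [Ax Ux]; have [k uk] := Au x Ax; exists k.
    by rewrite !fctE hU0// subr0 mulr1.
  - move=> k; have := uv (maxn j k); rewrite (PuE _ j).
    have : (P (u j * h j) <= P (u (maxn j k) * h j))%R.
      apply: additive_le => // x; rewrite !fctE ler_wpM2r//.
        by have [_] := ph j; exact.
      exact/ndu/leq_maxl.
    have : (P (u k * (1 - h j)) <= P (u (maxn j k) * (1 - h j)))%R.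
      apply: additive_le => // x; rewrite !fctE ler_wpM2r//.
        by have [_] := pc j; exact.
      exact/ndu/leq_maxr.
    move: je; lra.
apply: (le_trans (leeD (daniell_outer_le AU) (daniell_outer_le AC))).
by rewrite -!EFinD lee_fin; lra.
Qed.

(** If [u] is increasing and reaches [1] everywhere, then [1 - (u k \min 1)]
    decreases to [0]; this is where sigma-smoothness enters. *)
Lemma daniell_outerT : daniell_outer setT = (P 1)%:E.
Proof.
have p1 : Cbp (1%R : S -> R) := nonneg_bounded_continuous_cst ler01.
apply/eqP; rewrite eq_le; apply/andP; split.
  by apply/daniell_outer_le/majorized_fun.
apply: le_daniell_outer => v [u [pu ndu Su uv]]; rewrite lee_fin.
have [b1 _] := p1.
have pm k : Cbp (u k \min 1)%R.
  have [bu u0] := pu k; split; first exact: bounded_continuous_min.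
  by move=> x; rewrite /= le_min u0 ler01.
have m1 k x : ((u k \min 1) x <= (1%R : S -> R) x)%R by rewrite /= ge_min lexx orbT.
have d0 : decreasing_to0 (fun k => 1 - (u k \min 1))%R.
  split => [k|x k k' kk'|x].
  - by apply: bounded_continuousB => //; case: (pm k).
  - by rewrite !fctE lerB//= le_min !ge_min lexx orbT andbT ndu.
  - have [k uk] := Su x I; apply: cvg_near_cst; exists k => // k' /= kk'.
    by rewrite !fctE/= min_r ?subrr// (le_trans uk)// ndu.
have P1 k : (P (1 - (u k \min 1)) >= P 1 - v)%R.
  rewrite additiveB// lerB// (le_trans _ (uv k))//; apply: additive_le => // x.
  by rewrite /= ge_min lexx.
rewrite -subr_le0; apply: (cvgr_to_ge (smoothP d0)); exact: nearW.
Qed.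

End daniell_outer_measure.

(** * Representation of positive functionals by measures *)

Section daniell_representation.
Context {R : realType} {S : ptopologicalType}.
Variable d : S -> S -> R.
Hypotheses (dmet : is_metric d) (dtop : metrizes d).
Variables (P : (S -> R) -> R).
Hypotheses (P_ge0 : forall f, Cbp f -> 0 <= P f)
  (PD : forall f g, Cbp f -> Cbp g -> P (f + g) = P f + P g)
  (smoothP : sigma_smooth P).

Lemma daniell_outer_measure :
  exists m : {finite_measure set (borel S) -> \bar R},
    forall A : set S, m A = daniell_outer P A.
Proof.
pose om : {outer_measure set S -> \bar R} := HB.pack (daniell_outer P)
  (isOuterMeasure.Build R S (daniell_outer P)
    (daniell_outer0 P_ge0 PD) (daniell_outer_ge0 P_ge0)
    (@le_daniell_outer_set _ _ P)
    (daniell_outer_sigma_subadditive P_ge0 PD)).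
have borel_cara (A : set (borel S)) : measurable A -> om.-caratheodory A.
  apply: smallest_sub; first split.
  - exact: caratheodory_measurable_set0.
  - by move=> B mB; rewrite setTD; exact: caratheodory_measurable_setC.
  - exact: caratheodory_measurable_bigcup.
  - move=> U oU; have [h [bh h01 ndh hU0 hU1]] := open_indicator_approx dmet dtop oU.
    apply: le_caratheodory_measurable => B.
    exact: (daniell_outer_split P_ge0 PD B bh h01 ndh hU0 hU1).
have sadd : semi_sigma_additive (daniell_outer P : set (borel S) -> \bar R).
  move=> F mF tF mUF.
  apply: (@caratheodory_measure_sigma_additive R S om F) => //.
    by move=> i; exact: borel_cara.
  exact: borel_cara.
have fin : fin_num_fun (daniell_outer P : set (borel S) -> \bar R).
  by move=> A _; exact: daniell_outer_fin_num.
pose m : {measure set (borel S) -> \bar R} :=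
  HB.pack (daniell_outer P : set (borel S) -> \bar R)
  (isMeasure.Build _ (borel S) R (daniell_outer P : set (borel S) -> \bar R)
    (daniell_outer0 P_ge0 PD) (daniell_outer_ge0 P_ge0) sadd).
pose mf : {finite_measure set (borel S) -> \bar R} :=
  HB.pack (daniell_outer P : set (borel S) -> \bar R) m
   (Measure_isFinite.Build _ _ _ m fin).
by exists mf.
Qed.

Section integral.
Variable m : {finite_measure set (borel S) -> \bar R}.
Hypothesis mE : forall A : set S, m A = daniell_outer P A.

Lemma daniell_Rintegral_cst (c : R) : \int[m]_x c = c * P 1.
Proof.
have mT : fine (m setT) = P 1 by rewrite mE daniell_outerT.
by rewrite Rintegral_cst// -mT.
Qed.

(** A Markov inequality on one layer of thickness [n.+1%:R^-1]: the set where
    [h >= n.+1%:R^-1] carries [g], and [h *+ n.+1] majorizes its indicator.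
    A thickness of this form lets additivity stand in for homogeneity of [P]. *)
Lemma daniell_layer_le n g h : Cbp g -> Cbp h ->
  (forall x, g x <= n.+1%:R^-1) -> (forall x, 0 < g x -> n.+1%:R^-1 <= h x) ->
  \int[m]_x g x <= P h.
Proof.
move=> pg ph gn gh; have [[bg g0] [bh h0]] := (pg, ph).
set c : R := n.+1%:R^-1 in gn gh *; have c0 : 0 < c by rewrite invr_gt0 ltr0n.
pose A := h @^-1` `[c, +oo[.
have mA : measurable (A : set (borel S)).
  rewrite -[A]setTI; apply: continuous_borel_measurable => //.
  by case: bh.
have mAh : (m A <= (P h *+ n.+1)%:E)%E.
  rewrite mE -additiveMn//; apply: daniell_outer_le; apply: majorized_fun.
    split; last by move=> x; rewrite natmulfctE mulrn_wge0.
    rewrite -[n.+1]subn0 -sumr_const_nat; exact: bounded_continuous_sum.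
  move=> x; rewrite /A /= in_itv /= andbT => cx.
  by rewrite natmulfctE -mulr_natl -ler_pdivrMl ?ltr0n// mulr1.
have IA : \int[m]_x \1_A x = fine (m A).
  by rewrite /Rintegral integral_indic// setIT.
have iA : m.-integrable [set: borel S] (EFin \o \1_A) by exact: integrable_indic.
apply: (@le_trans _ _ (\int[m]_x (c * \1_A x))).
  apply: le_Rintegral => //; first exact: bounded_continuous_integrable.
    exact: (integrableZl measurableT c iA).
  move=> x _; rewrite indicE; case: (boolP (x \in A)) => xA.
    by rewrite mulr1 gn.
  rewrite mulr0 leNgt; apply/negP => /gh cx; move/negP: xA; apply.
  by rewrite inE /A /= in_itv /= andbT.
rewrite RintegralZl// IA /c mulrC ler_pdivrMr ?ltr0n// mulr_natr -lee_fin.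
by rewrite fineK// fin_num_measure.
Qed.

(** Cut [f] into horizontal layers of thickness [c]. The layer between heights
    [(k + 1) * c] and [(k + 2) * c] lives where the layer below it is full, so its
    integral is at most the value of [P] at the layer below. Summing up, the
    integral of [f] exceeds [P f] by at most that of the lowest layer, which is at
    most [c * P 1]. *)
Lemma daniell_integral_le f : Cbp f -> \int[m]_x f x <= P f.
Proof.
move=> pf; have [bf f0] := pf.
have linJ := Rintegral_linear m; set J := fun f : S -> R => \int[m]_x f x.
apply/ler_addgt0Pr => e e0.
have q0 : 0 <= P 1 / e.
  by rewrite divr_ge0 ?P_ge0 ?ltW//; exact: nonneg_bounded_continuous_cst.
pose n := Num.bound (P 1 / e); set c : R := n.+1%:R^-1.
have c0 : 0 < c by rewrite invr_gt0 ltr0n.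
have cPe : c * P 1 <= e.
  rewrite mulrC ler_pdivrMr ?ltr0n// mulrC -ler_pdivrMr//.
  by rewrite (le_trans (ltW (archi_boundP q0)))// ler_nat.
(* The part of f below height k * c; its increments are the layers. *)
pose t k : S -> R := f \min (fun=> k%:R * c).
have bt k : Cb (t k).
  by apply: bounded_continuous_min => //; exact: bounded_continuous_cst.
have ptc k : Cbp (t k).
  split=> // x; rewrite /t /= le_min f0 mulr_ge0//; exact: ltW.
have tS k x : t k x <= t k.+1 x.
  by rewrite /t /= le_min !ge_min lexx /= ler_wpM2r ?orbT ?ler_nat// ltW.
have pl k : Cbp (t k.+1 - t k) by exact: nonneg_bounded_continuousB.
have Jt k : J (t k.+1) <= J (t 1%N) + P (t k).
  elim: k => [|k ih].
    by rewrite lerDl P_ge0.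
  have layer : J (t k.+2 - t k.+1) <= P (t k.+1 - t k).
    apply: (@daniell_layer_le n) => // x; rewrite !fctE /t /= -/c.
      rewrite -[k.+2%:R]natr1 mulrDl mul1r !minEle.
      by case: (leP (f x)) => ?; case: (leP (f x)) => ?; lra.
    rewrite -[k.+2%:R]natr1 -[k.+1%:R]natr1 !mulrDl mul1r !minEle.
    by case: (leP (f x)) => ?; case: (leP (f x)) => ?; case: (leP (f x)) => ?; lra.
  have JB : J (t k.+2 - t k.+1) = J (t k.+2) - J (t k.+1).
    exact: (bounded_continuous_linearB linJ).
  rewrite JB (additiveB PD)// in layer; lra.
have J1 : J (t 1%N) <= c * P 1.
  rewrite -daniell_Rintegral_cst; apply: le_Rintegral => //.
  - exact: bounded_continuous_integrable.
  - by apply: bounded_continuous_integrable; exact: bounded_continuous_cst.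
  - by move=> x _; rewrite /t /= mul1r ge_min lexx orbT.
have /bounded_continuousP[_ [M fM]] := bf.
have [k fk] : exists k, t k = f.
  exists (Num.bound (`|M| / c)); apply/funext => x; apply/min_idPl.
  rewrite (le_trans (ler_norm _))// (le_trans (fM x))// (le_trans (ler_norm M))//.
  rewrite -ler_pdivrMr// ltW// archi_boundP// divr_ge0// ltW//.
have fk1 : t k.+1 = f.
  apply/funext => x; apply/eqP; rewrite eq_le; apply/andP; split.
    by rewrite /t /= ge_min lexx.
  by rewrite -[leLHS](congr1 (fun g => g x) fk) tS.
have := Jt k; rewrite fk fk1 -/(J f); lra.
Qed.

(** Applying the inequality to both [f] and [n - f] turns it into an equality,
    since the total masses agree. *)
Lemma daniell_integralE f : Cbp f -> \int[m]_x f x = P f.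
Proof.
move=> pf; have [bf f0] := pf; have /bounded_continuousP[_ [M fM]] := bf.
pose n := Num.bound `|M|.
have p1 : Cbp (1 : S -> R) := nonneg_bounded_continuous_cst ler01.
have pn : Cbp (1 *+ n : S -> R).
  rewrite -[n]subn0 -sumr_const_nat; exact: nonneg_bounded_continuous_sum.
have fn x : f x <= (1 *+ n : S -> R) x.
  rewrite natmulfctE (le_trans (ler_norm _))// (le_trans (fM x))//.
  by rewrite (le_trans (ler_norm M))// ltW// archi_boundP.
have [bn _] := pn.
have pnf : Cbp (1 *+ n - f) by exact: nonneg_bounded_continuousB.
have := daniell_integral_le pf; have := daniell_integral_le pnf.
rewrite (additiveB PD)// (bounded_continuous_linearB (Rintegral_linear m))//.
have -> : \int[m]_x (1 *+ n : S -> R) x = P (1 *+ n).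
  rewrite additiveMn// -[RHS]mulr_natl -daniell_Rintegral_cst.
  by apply: eq_Rintegral => x _; rewrite natmulfctE.
by move=> ? ?; apply/eqP; rewrite eq_le; apply/andP; split; lra.
Qed.

End integral.

Theorem daniell_representation :
  exists m : {finite_measure set (borel S) -> \bar R},
    forall f, Cbp f -> \int[m]_x f x = P f.
Proof.
have [m mE] := daniell_outer_measure.
by exists m => f pf; exact: daniell_integralE.
Qed.

End daniell_representation.

(** * Weak sequential completeness *)

(** The representation of both parts gives the identity on nonnegative functions;
    adding a constant reduces the others to these. *)
Lemma sigma_smooth_representation (R : realType) (S : ptopologicalType)
    (d : S -> S -> R) (L : (S -> R) -> R) :
  is_metric d -> metrizes d -> bounded_continuous_linear L -> sigma_smooth L ->
  exists nu : signed_measure R S,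
    forall f, Cb f -> charge_integral nu f = L f.
Proof.
move=> dmet dtop linL smoothL.
have linN := bounded_continuous_linearN linL; have smoothN := sigma_smoothN smoothL.
have [p pE] := daniell_representation dmet dtop (positive_part_ge0 linL smoothL)
  (positive_partD linL smoothL) (positive_part_sigma_smooth linL smoothL).
have [n nE] := daniell_representation dmet dtop (positive_part_ge0 linN smoothN)
  (positive_partD linN smoothN) (positive_part_sigma_smooth linN smoothN).
pose nu : signed_measure R S :=
  cadd (charge_of_finite_measure p) (copp (charge_of_finite_measure n)).
have linnu := charge_integral_linear nu.
have nuE f : Cbp f -> charge_integral nu f = L f.
  move=> pf; rewrite (@charge_integral_difference _ _ nu p n)//; last by case: pf.
  by rewrite pE// nE// positive_partN.
exists nu => f bf; have /bounded_continuousP[_ [M fM]] := bf.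
have bM : Cb (fun _ : S => `|M|) by exact: bounded_continuous_cst.
have pM : Cbp (fun _ : S => `|M|) by exact: nonneg_bounded_continuous_cst.
have pfM : Cbp (f + fun=> `|M|).
  split; first exact: bounded_continuousD.
  move=> x; rewrite !fctE -lerBlDr sub0r lerNl (le_trans (ler_norm _))// normrN.
  exact: le_trans (fM x) (ler_norm M).
have := nuE _ pfM; rewrite !bounded_continuous_linearD// (nuE _ pM).
exact: addIr.
Qed.

Theorem theorem5p1 (R : realType) (S : ptopologicalType) (hS : polish R S)
    (mu : nat -> signed_measure R S)
    (hmu : forall f : S -> R, bounded_continuous f ->
      cvg (charge_integral (mu n) f @[n --> \oo])) :
  exists mu_star : signed_measure R S,
    forall f : S -> R, bounded_continuous f ->
      charge_integral (mu n) f @[n --> \oo] --> charge_integral mu_star f.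
Proof.
have [_ [d [dmet dtop _]]] := hS.
have linI n := charge_integral_linear (mu n).
have smoothI n := @charge_integral_variation_sigma_smooth _ _ (mu n).
pose L f := limn (fun n => charge_integral (mu n) f).
have IL f : bounded_continuous f -> charge_integral (mu n) f @[n --> \oo] --> L f.
  exact: hmu.
have [mu_star mu_starE] := sigma_smooth_representation dmet dtop
  (limit_bounded_continuous_linear linI IL) (limit_sigma_smooth linI smoothI IL).
by exists mu_star => f bf; rewrite mu_starE//; exact: IL.
Qed.
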